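(* Let $T$ be an automorphism of a measurable space $(X,\mathcal F)$, let $\xi$ be a countable measurable partition of $X$ and let $\mu$ be a $T$-invariant probability measure (the entropy $H_\mu(\xi)$ is not assumed to be finite). Assume that there exist a sequence of $T$-invariant probability measures $\mu_n$ ($n\ge1$) and sequences of numbers $r_n\in\mathbb N$, $\varepsilon_n>0$ such that (i) $\lim_{n\to\infty} r_n=\infty$ and $\lim_{n\to\infty}\varepsilon_n=0$; (ii) $|\mu(A)-\mu_n(A)|\le \varepsilon_n\mu_n(A)$ for all $n\ge 1$ and all atoms $A$ of the partition $\bigvee_{i=0}^{r_n}T^{-i}\xi$; (iii) $\xi$ is a generator for $(T,\mu)$ and for $(T,\mu_n)$, for every $n\ge 1$. Number the atoms of $\xi$ by positive integers in an arbitrary way, let $q(1)<q(2)<\cdots$ be an increasing sequence of positive integers, and for $m\ge1$ let $\xi_m$ be the finite partition of $X$ obtained from $\xi$ by replacing all the atoms with labels $\ge q(m)$ by their union. Then $$h_\mu(T)\ge\limsup_{m\to\infty}\ \limsup_{n\to\infty}\ h_{\mu_n}(T,\xi_m).$$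
   Context: An automorphism $T$ of a measurable space $(X,\mathcal F)$ is an invertible map $X\to X$ that is measurable together with its inverse. All measures are defined on $\mathcal F$. For a countable measurable partition $\eta$ and a probability measure $\mu$, $H_\mu(\eta)=-\sum_{B}\mu(B)\ln\mu(B)$ (sum over the atoms $B$ of $\eta$, with $0\ln 0=0$). For a $T$-invariant probability measure $\mu$, $h_\mu(T)$ denotes the Kolmogorov--Sinai entropy of $T$ with respect to $\mu$ (possibly $+\infty$), and for a finite measurable partition $\eta$, $h_\mu(T,\eta)=\lim_{n\to\infty}\frac1n H_\mu\big(\bigvee_{i=0}^{n-1}T^{-i}\eta\big)$ is the entropy of $T$ with respect to $\eta$ and $\mu$. $\bigvee$ denotes the common refinement (join) of partitions. A countable measurable partition $\eta$ is called a generator (generating partition) for $(T,\mu)$ if the $\sigma$-algebra generated by the partitions $T^i\eta$, $i\in\mathbb Z$, coincides with $\mathcal F$ modulo $\mu$-null sets. *)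

(* Defs.v *)
From mathcomp Require Import all_boot all_order all_algebra.
From mathcomp Require Import all_classical all_reals all_analysis.
Set Implicit Arguments.
Unset Strict Implicit.
Unset Printing Implicit Defensive.
Import Order.TTheory GRing.Theory Num.Theory.
Import numFieldNormedType.Exports.
Local Open Scope classical_set_scope.
Local Open Scope ring_scope.

Definition automorphism d (X : measurableType d) (T : X -> X) : Prop :=
  measurable_fun setT T /\
  exists Tinv : X -> X,
    [/\ cancel T Tinv, cancel Tinv T & measurable_fun setT Tinv].

Definition invariant_measure d (X : measurableType d) (R : realType) (T : X -> X)
    (mu : probability X R) : Prop :=
  forall A, measurable A -> mu (T @^-1` A) = mu A.

(* A partition is represented by the set of its atoms, which are nonempty. *)
Definition measurable_partition d (X : measurableType d)
    (eta : set (set X)) : Prop :=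
  partition eta id setT /\ eta `<=` measurable.

Definition preimage_partition (X : Type) (f : X -> X) (eta : set (set X)) :
    set (set X) :=
  [set f @^-1` A | A in eta].

Definition partition_join (X : Type) (eta zeta : set (set X)) : set (set X) :=
  [set A `&` B | A in eta & B in zeta] `\ set0.

(* The join of T^{-i} eta over 0 <= i < n; it is the trivial partition if
   n = 0. *)
Definition join_iter (X : Type) (T : X -> X) (eta : set (set X)) (n : nat) :
    set (set X) :=
  \big[@partition_join X/[set setT]]_(i < n) preimage_partition (iter i T) eta.

(* The convention 0 ln 0 = 0 holds because ln 0 = 0 in the library. *)
Definition partition_entropy d (X : measurableType d) (R : realType)
    (mu : probability X R) (eta : set (set X)) : \bar R :=
  \esum_(B in eta) (- (fine (mu B) * ln (fine (mu B))))%:E.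

Definition entropy_wrt d (X : measurableType d) (R : realType)
    (mu : probability X R) (T : X -> X) (eta : set (set X)) : \bar R :=
  limn (fun n : nat => ((n%:R^-1)%:E * partition_entropy mu (join_iter T eta n))%E).

(* Supremum over the finite measurable partitions. *)
Definition ks_entropy d (X : measurableType d) (R : realType)
    (mu : probability X R) (T : X -> X) : \bar R :=
  ereal_sup [set entropy_wrt mu T eta |
    eta in [set eta | measurable_partition eta /\ finite_set eta]].

(* T^i A for i in Z, when T is invertible: negative powers are written as
   preimages. *)
Definition iterz_image (X : Type) (T : X -> X) (i : int) (A : set X) : set X :=
  match i with
  | Posz n => iter n T @` A
  | Negz n => iter n.+1 T @^-1` A
  end.

Definition eq_mod_null d (X : measurableType d) (R : realType)
    (mu : probability X R) (F G : set (set X)) : Prop :=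
  (forall A, F A -> exists2 B, G B & mu (A `+` B) = 0%E) /\
  (forall B, G B -> exists2 A, F A & mu (A `+` B) = 0%E).

Definition is_generator d (X : measurableType d) (R : realType)
    (mu : probability X R) (T : X -> X) (eta : set (set X)) : Prop :=
  eq_mod_null mu measurable
    <<s \bigcup_(i in [set: int]) [set iterz_image T i A | A in eta] >>.

(* Replace all the atoms with label >= k by their union; removing the empty
   set matters only when there is no such atom. *)
Definition merge_tail (X : Type) (xi : set (set X)) (label : set X -> nat)
    (k : nat) : set (set X) :=
  ([set A | xi A /\ (label A < k)%N] `|`
   [set \bigcup_(A in [set A | xi A /\ (k <= label A)%N]) A]) `\ set0.

(* Main.v *)
(* The subadditivity of n |-> H_mu(eta^n), where eta^n is the join of T^{-i} eta
   over i < n, gives h_mu(T, eta) = inf_k H_mu(eta^k) / k for every finite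
   partition eta (Fekete). Fix eta = xi_m and k. Once r_n >= k, each of the
   finitely many atoms of eta^k is a countable union of atoms of the join
   in (ii), so the multiplicative estimate (ii) sums up to the same estimate on
   eta^k, whence H_{mu_n}(eta^k) -> H_mu(eta^k). Therefore
   limsup_n h_{mu_n}(T, eta) <= lim_n H_{mu_n}(eta^k) / k = H_mu(eta^k) / k
   for all k >= 1, and the infimum over k is h_mu(T, eta) <= h_mu(T). *)
Require Import Defs.
From mathcomp Require Import all_boot all_order all_algebra.
From mathcomp Require Import lra.
From mathcomp Require Import all_classical all_reals all_analysis.
Set Implicit Arguments.
Unset Strict Implicit.
Unset Printing Implicit Defensive.
Import Order.TTheory GRing.Theory Num.Theory.
Import numFieldNormedType.Exports.
Local Open Scope classical_set_scope.
Local Open Scope ring_scope.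

(** * Joins and refinements of partitions *)

Lemma partition_joinA (X : Type) (eta zeta theta : set (set X)) :
  partition_join eta (partition_join zeta theta) =
  partition_join (partition_join eta zeta) theta.
Proof.
apply/seteqP; split=> C.
- move=> [[A etaA [D [[B zetaB [E thetaE <-]] _] <-]]] C0.
  split=> //; exists (A `&` B); last by exists E => //; rewrite setIA.
  split; first by exists A => //; exists B.
  by move=> /= AB0; apply: C0; rewrite /= setIA AB0 set0I.
- move=> [[D [[A etaA [B zetaB <-]] _] [E thetaE <-]]] C0.
  split=> //; exists A => //; exists (B `&` E); last by rewrite setIA.
  split; first by exists B => //; exists E.
  by move=> /= BE0; apply: C0; rewrite /= -setIA BE0 setI0.
Qed.

Lemma partition_join1 (X : Type) (zeta : set (set X)) : ~ zeta set0 ->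
  partition_join [set setT] zeta = zeta.
Proof.
move=> zeta0; apply/seteqP; split=> C.
- by move=> [[_ -> [B zB <-]] _]; rewrite setTI.
- move=> zC; split; last by move=> /= C0; rewrite C0 in zC.
  by exists setT => //; exists C => //; rewrite setTI.
Qed.

(** Here [cancel S T] says that [T] is onto, so a set is determined by its preimage under [T]. *)
Lemma preimage_set_inj (X : Type) (T S : X -> X) : cancel S T ->
  injective (fun A : set X => T @^-1` A).
Proof.
move=> ST A B AB; apply/seteqP; split=> x Ax; rewrite -[x]ST.
- by rewrite -[B (T (S x))]/((T @^-1` B) (S x)) -AB /preimage /= ST.
- by rewrite -[A (T (S x))]/((T @^-1` A) (S x)) AB /preimage /= ST.
Qed.

(** Preimages commute with intersections. Surjectivity of [T] keeps a nonempty intersection nonempty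
    after pulling back, so both sides discard the same pairs of atoms. *)
Lemma preimage_partition_join (X : Type) (T S : X -> X) (eta zeta : set (set X)) :
  cancel S T ->
  preimage_partition T (partition_join eta zeta) =
  partition_join (preimage_partition T eta) (preimage_partition T zeta).
Proof.
move=> ST; apply/seteqP; split=> C.
- move=> [_ [[A eA [B zB <-]] AB0] <-]; split.
    by exists (T @^-1` A); [exists A | exists (T @^-1` B); first exists B].
  by move=> TAB0; apply: AB0; apply: (preimage_set_inj ST); rewrite TAB0.
- move=> [[_ [A eA <-] [_ [B zB <-] <-]] C0]; exists (A `&` B) => //.
  split; first by exists A => //; exists B.
  by move=> /= AB0; apply: C0; rewrite -preimage_setI AB0 preimage_set0.
Qed.

Lemma preimage_partition_comp (X : Type) (f g : X -> X) (eta : set (set X)) :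
  preimage_partition f (preimage_partition g eta) =
  preimage_partition (g \o f) eta.
Proof.
apply/seteqP; split=> C; first by move=> [_ [A eA <-] <-]; exists A.
by move=> [A eA <-]; exists (g @^-1` A) => //; exists A.
Qed.

Lemma preimage_partition_id (X : Type) (eta : set (set X)) :
  preimage_partition id eta = eta.
Proof. by rewrite /preimage_partition image_id. Qed.

(** The factor [i = 0] is split off and one [T] is pulled out of every other factor. The inductions
    on the length of a join rest on this recursion. *)
Lemma join_iterS (X : Type) (T S : X -> X) (eta : set (set X)) n :
  cancel S T ->
  join_iter T eta n.+1 =
  partition_join eta (preimage_partition T (join_iter T eta n)).
Proof.
move=> ST; rewrite /join_iter big_ord_recl preimage_partition_id.
congr partition_join.
rewrite (big_morph (preimage_partition T)
  (fun e z => preimage_partition_join e z ST)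
  (_ : preimage_partition T [set setT] = [set setT])); last first.
  by rewrite /preimage_partition image_set1 preimage_setT.
apply: eq_bigr => i _; rewrite preimage_partition_comp.
by congr preimage_partition; apply/funext => x; rewrite /= -iterSr.
Qed.

Lemma partition_not_set0 d (X : measurableType d) (eta : set (set X)) :
  measurable_partition eta -> ~ eta set0.
Proof. by move=> [[_ _ ne] _] /ne /set0P /eqP. Qed.

Lemma measurable_partition_join d (X : measurableType d)
    (eta zeta : set (set X)) :
  measurable_partition eta -> measurable_partition zeta ->
  measurable_partition (partition_join eta zeta).
Proof.
move=> [[ceta teta neta] meta] [[czeta tzeta nzeta] mzeta]; split; last first.
  by move=> _ [[A eA [B zB <-]] _]; apply: measurableI; [exact: meta|exact: mzeta].
split.
- rewrite -subTset => x _.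
  have: cover eta id x by rewrite ceta.
  have: cover zeta id x by rewrite czeta.
  move=> [B zB Bx] [A eA Ax]; exists (A `&` B) => //; split.
    by exists A => //; exists B.
  by move=> /= AB0; have : set0 x by rewrite -AB0.
- move=> _ _ [[A eA [B zB <-]] _] [[A' eA' [B' zB' <-]] _].
  move=> [x [[Ax Bx] [Ax' Bx']]].
  have -> : A = A' := teta A A' eA eA' (ex_intro _ x (conj Ax Ax')).
  by have -> : B = B' := tzeta B B' zB zB' (ex_intro _ x (conj Bx Bx')).
- by move=> C [_ /= /eqP/set0P].
Qed.

Lemma measurable_preimage_partition d (X : measurableType d) (T S : X -> X)
    (eta : set (set X)) :
  measurable_fun setT T -> cancel S T -> measurable_partition eta ->
  measurable_partition (preimage_partition T eta).
Proof.
move=> mT ST [[ceta teta neta] meta]; split; last first.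
  by move=> _ [A eA <-]; rewrite -[X in measurable X]setTI; apply: mT => //; exact: meta.
split.
- rewrite -subTset => x _; have: cover eta id (T x) by rewrite ceta.
  by move=> [A eA Ax]; exists (T @^-1` A) => //; exists A.
- move=> _ _ [A eA <-] [B eB <-] [x [Ax Bx]].
  by have -> : A = B := teta A B eA eB (ex_intro _ (T x) (conj Ax Bx)).
- by move=> _ [A eA <-]; have [x Ax] := neta _ eA; exists (S x); rewrite /preimage /= ST.
Qed.

Lemma measurable_partition1 d (X : measurableType d) :
  [set: X] !=set0 -> measurable_partition [set [set: X]].
Proof.
move=> X0; split; last by move=> _ ->.
split; first by rewrite /cover bigcup_set1.
- by move=> A B -> ->.
- by move=> _ ->.
Qed.

Lemma measurable_join_iter d (X : measurableType d) (T S : X -> X)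
    (eta : set (set X)) n :
  [set: X] !=set0 ->
  measurable_fun setT T -> cancel S T -> measurable_partition eta ->
  measurable_partition (join_iter T eta n).
Proof.
move=> X0 mT ST meta; elim: n => [|n ih].
  (* For [n = 0] the only atom is [setT], which has to be nonempty: hence the hypothesis on [X]. *)
  by rewrite /join_iter big_ord0; exact: measurable_partition1.
rewrite (join_iterS _ _ ST); apply: measurable_partition_join => //.
exact: measurable_preimage_partition ST _.
Qed.

(** Induction on [n], by associativity of the join and its compatibility with preimages. This form
    serves both the subadditivity of entropy and the comparison of joins of different lengths. *)
Lemma join_iterD d (X : measurableType d) (T S : X -> X) (eta : set (set X)) n m :
  [set: X] !=set0 ->
  measurable_fun setT T -> cancel S T -> measurable_partition eta ->
  join_iter T eta (n + m) =
  partition_join (join_iter T eta n)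
    (preimage_partition (iter n T) (join_iter T eta m)).
Proof.
move=> X0 mT ST meta; elim: n => [|n ih].
  rewrite add0n preimage_partition_id {2}/join_iter big_ord0.
  by rewrite partition_join1//; apply/partition_not_set0/(measurable_join_iter _ _ _ ST).
rewrite addSn !(join_iterS _ _ ST) ih (preimage_partition_join _ _ ST).
rewrite partition_joinA preimage_partition_comp.
by congr (partition_join _ (preimage_partition _ _));
  apply/funext => x /=; rewrite -iterSr.
Qed.

Lemma finite_partition_join (X : Type) (eta zeta : set (set X)) :
  finite_set eta -> finite_set zeta -> finite_set (partition_join eta zeta).
Proof. by move=> fe fz; apply/finite_setD/finite_image2. Qed.

Lemma finite_join_iter (X : Type) (T S : X -> X) (eta : set (set X)) n :
  cancel S T -> finite_set eta -> finite_set (join_iter T eta n).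
Proof.
move=> ST feta; elim: n => [|n ih].
  by rewrite /join_iter big_ord0; exact: finite_set1.
by rewrite (join_iterS _ _ ST); apply/finite_partition_join/finite_image.
Qed.

Lemma countable_join_iter (X : Type) (T S : X -> X) (eta : set (set X)) n :
  cancel S T -> countable eta -> countable (join_iter T eta n).
Proof.
move=> ST ceta; elim: n => [|n ih].
  by rewrite /join_iter big_ord0; exact: countable1.
rewrite (join_iterS _ _ ST).
(* Every atom of the join is the value of this map at a pair taken from a product of countable
   sets. *)
pose f (p : set X * set X) := p.1 `&` T @^-1` p.2.
apply: (@sub_countable _ _ _ (eta `*` join_iter T eta n)); last exact: countableX.
apply: card_le_trans (card_image_le f _); apply: subset_card_le.
by move=> _ [[A eA [_ [B nB <-] <-]] _]; exists (A, B).
Qed.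

(** The first argument is the coarser partition. Between partitions of the same space, every atom of
    [eta] is then a union of atoms of [xi]. *)
Definition refines (X : Type) (eta xi : set (set X)) : Prop :=
  forall B, xi B -> exists2 A, eta A & B `<=` A.

Lemma refines_join (X : Type) (eta eta' xi xi' : set (set X)) :
  refines eta xi -> refines eta' xi' ->
  refines (partition_join eta eta') (partition_join xi xi').
Proof.
move=> r r' _ [[B xiB [B' xiB' <-]] BB0].
have [A eA BA] := r _ xiB; have [A' eA' BA'] := r' _ xiB'.
exists (A `&` A'); last exact: setISS.
split; first by exists A => //; exists A'.
move=> /= AA0; apply: BB0; rewrite /= -subset0 -AA0; exact: setISS.
Qed.

Lemma refines_preimage (X : Type) (T : X -> X) (eta xi : set (set X)) :
  refines eta xi -> refines (preimage_partition T eta) (preimage_partition T xi).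
Proof.
move=> r _ [B xiB <-]; have [A eA BA] := r _ xiB.
by exists (T @^-1` A); [exists A | exact: preimage_subset].
Qed.

Lemma refines_join_iter (X : Type) (T S : X -> X) (eta xi : set (set X)) n :
  cancel S T -> refines eta xi ->
  refines (join_iter T eta n) (join_iter T xi n).
Proof.
move=> ST r; elim: n => [|n ih].
  by rewrite /join_iter !big_ord0 => _ ->; exists setT.
rewrite !(join_iterS _ _ ST); apply: refines_join => //.
exact: refines_preimage.
Qed.

Lemma refines_join_iter_leq d (X : measurableType d) (T S : X -> X)
    (eta : set (set X)) k n :
  [set: X] !=set0 ->
  measurable_fun setT T -> cancel S T -> measurable_partition eta ->
  (k <= n)%N -> refines (join_iter T eta k) (join_iter T eta n).
Proof.
move=> X0 mT ST meta kn; rewrite -(subnKC kn) (join_iterD _ _ X0 mT ST meta).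
by move=> _ [[A eA [B _ <-]] _]; exists A => //; exact: subIsetl.
Qed.

Lemma refines_trans (X : Type) (eta zeta xi : set (set X)) :
  refines eta zeta -> refines zeta xi -> refines eta xi.
Proof.
move=> r r' C xiC; have [B zB CB] := r' _ xiC; have [A eA BA] := r _ zB.
by exists A => //; exact: subset_trans BA.
Qed.

(** * Entropy of a finite partition *)

(** Disjointness of atoms makes a pair recoverable from its intersection when this is nonempty. The
    pairs with empty intersection, absent from the join, contribute [F set0 = 0] to the double
    sum. *)
Lemma fsbig_partition_join d (X : measurableType d) (R : realType)
    (eta zeta : set (set X)) (F : set X -> R) :
  measurable_partition eta -> finite_set eta ->
  measurable_partition zeta -> finite_set zeta -> F set0 = 0 ->
  \sum_(C \in partition_join eta zeta) F C =
  \sum_(A \in eta) \sum_(B \in zeta) F (A `&` B).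
Proof.
move=> [[_ teta _] _] feta [[_ tzeta _] _] fzeta F0.
pose h (p : set X * set X) := p.1 `&` p.2.
pose D := (eta `*` zeta) `&` [set p | h p !=set0].
have -> : partition_join eta zeta = h @` D.
  apply/seteqP; split=> C.
    move=> [[A eA [B zB <-]] /eqP/set0P AB0]; exists (A, B) => //.
  by move=> [[A B] [[eA zB] /set0P/eqP AB0] <-]; split => //; exists A => //; exists B.
rewrite fsbig_image; last first.
  move=> [A B] [A' B'] /set_mem[[/= eA zB] [x [Ax Bx]]] /set_mem[[/= eA' zB'] _] hh.
  have [A'x B'x] : h (A', B') x by rewrite -hh.
  have -> : A = A' := teta A A' eA eA' (ex_intro _ x (conj Ax A'x)).
  by have -> : B = B' := tzeta B B' zB zB' (ex_intro _ x (conj Bx B'x)).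
rewrite pair_fsbig//; apply: fsbig_widen; first exact: subIsetl.
move=> p [pP pD]; rewrite /preimage /= -/(h p).
have [->//|/set0P hp] := eqVneq (h p) set0; exfalso; apply: pD; split => //.
Qed.

Lemma fine_measure_partition d (X : measurableType d) (R : realType)
    (mu : probability X R) (zeta : set (set X)) (A : set X) :
  measurable_partition zeta -> finite_set zeta -> measurable A ->
  \sum_(B \in zeta) fine (mu (A `&` B)) = fine (mu A).
Proof.
move=> [[czeta tzeta _] mzeta] fzeta mA; apply: EFin_inj.
rewrite -fsumEFin//.
have -> : ((fine (mu A))%:E = mu (\bigcup_(B in zeta) (A `&` B)))%E.
  rewrite -setI_bigcupr -[\bigcup_(i in _) _]/(cover zeta id) czeta setIT.
  by rewrite fineK// fin_num_measure.
have mAB B : zeta B -> measurable (A `&` B).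
  by move=> zB; apply: measurableI => //; exact: mzeta.
rewrite measure_fin_bigcup//; last first.
  move=> B B' zB zB' [x [[_ Bx] [_ B'x]]].
  exact: (tzeta B B' zB zB' (ex_intro _ x (conj Bx B'x))).
by apply: eq_fsbigr => B /set_mem zB; rewrite fineK// fin_num_measure//; exact: mAB.
Qed.

(** A real-valued form of [partition_entropy], meant for finite partitions, so that sums are
    rearranged and limits taken without extended reals. *)
Definition fin_entropy d (X : measurableType d) (R : realType)
    (mu : probability X R) (eta : set (set X)) : R :=
  \sum_(B \in eta) - (fine (mu B) * ln (fine (mu B))).

Lemma fine_probability d (X : measurableType d) (R : realType)
    (mu : probability X R) (A : set X) : measurable A ->
  0 <= fine (mu A) <= 1.
Proof.
move=> mA; rewrite fine_ge0//=; rewrite -[leRHS]/(fine 1%:E) fine_le//.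
- by rewrite fin_num_measure.
- exact: probability_le1.
Qed.

Lemma entropy_term_ge0 (R : realType) (p : R) : 0 <= p <= 1 -> 0 <= - (p * ln p).
Proof. by move=> /andP[p0 p1]; rewrite oppr_ge0 mulr_ge0_le0// ln_le0. Qed.

Lemma fin_entropy_ge0 d (X : measurableType d) (R : realType)
    (mu : probability X R) (eta : set (set X)) : eta `<=` measurable ->
  0 <= fin_entropy mu eta.
Proof.
move=> meta; apply: fsumr_ge0 => B eB.
by apply/entropy_term_ge0/fine_probability/meta.
Qed.

Lemma partition_entropyE d (X : measurableType d) (R : realType)
    (mu : probability X R) (eta : set (set X)) :
  finite_set eta -> eta `<=` measurable ->
  partition_entropy mu eta = (fin_entropy mu eta)%:E.
Proof.
move=> feta meta; rewrite /partition_entropy esum_fset//.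
  by rewrite -fsumEFin.
move=> B /set_mem eB; rewrite lee_fin.
by apply/entropy_term_ge0/fine_probability/meta.
Qed.

(* [ln z <= z - 1] at [z = a b / p]. *)
Lemma entropy_term_le (R : realType) (p a b : R) : 0 <= p -> p <= a -> p <= b ->
  - (p * ln p) <= p * - ln a + p * - ln b + (a * b + -1 * p).
Proof.
rewrite le_eqVlt => /predU1P[<- a0 b0|p0 pa pb].
  by rewrite !mul0r mulr0 oppr0 !add0r addr0 mulr_ge0.
have a0 : 0 < a by exact: lt_le_trans pa.
have b0 : 0 < b by exact: lt_le_trans pb.
have q0 : 0 < a * b / p by rewrite divr_gt0// mulr_gt0.
have := @le_ln1Dx R (a * b / p - 1).
rewrite ltrBrDr addNr addrC subrK => /(_ q0).
rewrite ln_div ?posrE ?mulr_gt0// lnM ?posrE// -(ler_pM2l p0) => h.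
have e : p * (a * b / p - 1) = a * b - p.
  by rewrite mulrBr mulr1 mulrCA divff ?mulr1// gt_eqF.
rewrite e !mulrDr mulrN in h; rewrite !mulrN mulN1r; lra.
Qed.

(** Summing [entropy_term_le] over all pairs of atoms, with [p] the joint mass and [a], [b] the two
    marginals, gives the two entropies plus a correction that vanishes. *)
Lemma fin_entropy_join d (X : measurableType d) (R : realType)
    (mu : probability X R) (eta zeta : set (set X)) :
  measurable_partition eta -> finite_set eta ->
  measurable_partition zeta -> finite_set zeta ->
  fin_entropy mu (partition_join eta zeta) <=
  fin_entropy mu eta + fin_entropy mu zeta.
Proof.
move=> peta feta pzeta fzeta.
have [_ meta] := peta; have [_ mzeta] := pzeta.
rewrite [leLHS]fsbig_partition_join// ?measure0 ?mul0r ?oppr0//.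
pose p (A B : set X) := fine (mu (A `&` B)); pose a A := fine (mu A).
have sumr A : eta A -> \sum_(B \in zeta) p A B = a A.
  by move=> eA; apply: fine_measure_partition => //; exact: meta.
have sumc B : zeta B -> \sum_(A \in eta) p A B = a B.
  move=> zB; rewrite /a -(fine_measure_partition mu peta)//; last exact: mzeta.
  by apply: eq_fsbigr => A _; rewrite /p setIC.
have sum1 theta : measurable_partition theta -> finite_set theta ->
    \sum_(A \in theta) a A = 1.
  move=> pt ft; rewrite -[RHS]/(fine 1%:E) -(@probability_setT _ _ _ mu).
  rewrite -(fine_measure_partition mu pt)//.
  by apply: eq_fsbigr => A _; rewrite setTI.
have E1 : \sum_(A \in eta) \sum_(B \in zeta) p A B * - ln (a A) = fin_entropy mu eta.
  apply: eq_fsbigr => A /set_mem eA; by rewrite -mulr_fsuml sumr// mulrN.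
have E2 : \sum_(A \in eta) \sum_(B \in zeta) p A B * - ln (a B) = fin_entropy mu zeta.
  rewrite exchange_fsbig//.
  apply: eq_fsbigr => B /set_mem zB.
  by rewrite -mulr_fsuml sumc// mulrN.
(* Products of marginals and joint masses both add up to 1, so the correction cancels. *)
have E3 : \sum_(A \in eta) \sum_(B \in zeta) (a A * a B + -1 * p A B) = 0.
  transitivity (\sum_(A \in eta) (a A * 1 + -1 * a A)).
    apply: eq_fsbigr => A /set_mem eA.
    by rewrite fsbig_split//= -!mulr_fsumr sumr// sum1.
  rewrite fsbig_split//= -mulr_fsuml -mulr_fsumr !sum1//.
  by rewrite mulr1 mulN1r subrr.
rewrite -E1 -E2 -[leRHS]addr0 -[X in _ <= _ + X]E3.
rewrite !(fsbig_finite _ _ feta) -!big_split /=.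
rewrite big_seq [leRHS]big_seq; apply: ler_sum => A.
rewrite in_fset_set// => /set_mem eA.
rewrite !(fsbig_finite _ _ fzeta) -!big_split /=.
rewrite big_seq [leRHS]big_seq; apply: ler_sum => B.
rewrite in_fset_set// => /set_mem zB.
have mAB : measurable (A `&` B) by apply: measurableI; [exact: meta|exact: mzeta].
apply: entropy_term_le.
- by rewrite fine_ge0.
- apply: fine_le; rewrite ?fin_num_measure//; first exact: meta.
  by apply: le_measure; rewrite ?inE//; exact: meta.
- apply: fine_le; rewrite ?fin_num_measure//; first exact: mzeta.
  by apply: le_measure; rewrite ?inE//; exact: mzeta.
Qed.

Lemma fin_entropy_preimage d (X : measurableType d) (R : realType)
    (mu : probability X R) (T S : X -> X) (eta : set (set X)) :
  cancel S T -> invariant_measure T mu -> eta `<=` measurable ->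
  fin_entropy mu (preimage_partition T eta) = fin_entropy mu eta.
Proof.
move=> ST inv meta; rewrite /fin_entropy fsbig_image; last first.
  by move=> A B _ _; exact: preimage_set_inj.
by apply: eq_fsbigr => A /set_mem eA; rewrite inv//; exact: meta.
Qed.

(** * Subadditive sequences *)

(** Blocks of length [k] are peeled off one at a time. For [k = 0] the quotient is 0 and the
    remainder is [n] by convention, and the bound is an equality. *)
Lemma subadditive_divn (R : realType) (a : nat -> R) (k n : nat) :
  (forall n m, a (n + m)%N <= a n + a m) ->
  a n <= (n %/ k)%:R * a k + a (n %% k)%N.
Proof.
move=> sub; rewrite {1}(divn_eq n k).
elim: (n %/ k)%N => [|q ih]; first by rewrite mul0n mul0r !add0r.
rewrite mulSn -addnA; apply: (le_trans (sub _ _)).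
by rewrite -natr1 mulrDl mul1r (addrC _ (a k)) -addrA lerD2l.
Qed.

(** Fekete's lemma for nonnegative sequences. For a [k] that nearly attains the infimum, division
    with remainder bounds the mean at [n] by the mean at [k] plus a bounded quantity divided by
    [n]. *)
Lemma fekete (R : realType) (a : nat -> R) :
  (forall n, 0 <= a n) -> (forall n m, a (n + m)%N <= a n + a m) ->
  n%:R^-1 * a n @[n --> \oo] -->
  inf [set k%:R^-1 * a k | k in [set k | (0 < k)%N]].
Proof.
move=> a0 sub; set E := [set _ | _ in _]; set l := inf E.
have lbE : has_lbound E by exists 0 => _ [k _ <-]; rewrite mulr_ge0// invr_ge0.
have infE : has_inf E by split => //; exists (1%:R^-1 * a 1%N); exists 1%N.
apply/cvgrPdist_le => e e0.
have [_ [k k0 <-] kl] := inf_adherent (divr_gt0 e0 (ltr0Sn _ 1)) infE.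
(* Remainders modulo [k] are below [k], so by nonnegativity this sum bounds every [a (n %% k)],
   independently of [n]. *)
pose M := \sum_(i < k) a i.
have M0 : 0 <= M by exact: sumr_ge0.
near=> n.
have n0 : (0 < n)%N by near: n; exact: nbhs_infty_gt.
have n0R : 0 < n%:R :> R by rewrite ltr0n.
have ln : l <= n%:R^-1 * a n by apply: ge_inf => //; exists n.
rewrite ler_norml; apply/andP; split; last first.
  by rewrite (@le_trans _ _ 0)// ?subr_le0// ltW.
have Mn : n%:R^-1 * M <= e / 2.
  rewrite ler_pdivrMl// mulrC -ler_pdivrMl ?divr_gt0// mulrC.
  by near: n; exact: nbhs_infty_ger.
have asM : a (n %% k)%N <= M.
  rewrite /M (bigD1 (Ordinal (ltn_pmod n k0)))//= lerDl.
  by apply: sumr_ge0 => i _.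
(* The quotient times [k] is at most [n], and [a k] is nonnegative. *)
have qk : n%:R^-1 * ((n %/ k)%:R * a k) <= k%:R^-1 * a k.
  rewrite mulrA ler_wpM2r// ler_pdivrMl// ler_pdivlMr ?ltr0n//.
  by rewrite -natrM ler_nat leq_divM.
have := subadditive_divn k n sub.
rewrite -(ler_pM2l (x := n%:R^-1)) ?invr_gt0// mulrDr => h.
have : n%:R^-1 * a (n %% k)%N <= n%:R^-1 * M by rewrite ler_wpM2l// invr_ge0 ltW.
rewrite /= in kl *; rewrite -/l in kl; lra.
Unshelve. all: by end_near. Qed.

(** * Transfer of the closeness to coarser partitions *)

(** Each coarse atom is a countable disjoint union of fine atoms, so countable additivity carries
    the inequality over. General measures are allowed because [m2] will be a probability plus a
    multiple of another one. *)
Lemma le_measure_refined d (X : measurableType d) (R : realType)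
    (m1 m2 : {measure set X -> \bar R}) (eta xi : set (set X)) :
  measurable_partition eta -> measurable_partition xi -> countable xi ->
  refines eta xi -> (forall B, xi B -> (m1 B <= m2 B)%E) ->
  forall A, eta A -> (m1 A <= m2 A)%E.
Proof.
move=> [[_ teta _] meta] [[cxi_ txi _] mxi] /countable_injP[f finj] r m12 A eA.
(* The fine atoms inside [A] are indexed by [nat] through the injection [f]; a number that labels
   none of them gives the empty set. *)
pose F j := \bigcup_(B in [set B | [/\ xi B, B `<=` A & f B = j]]) B.
have AF : A = \bigcup_j F j.
  apply/seteqP; split=> x; last by move=> [j _ [B [_ BA _]]]; exact: BA.
  move=> Ax; have [B xiB Bx] : cover xi id x by rewrite cxi_.
  have [A' eA' BA'] := r _ xiB.
  exists (f B) => //; exists B => //; split => //.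
  by have -> : A = A' := teta A A' eA eA' (ex_intro _ x (conj Ax (BA' _ Bx))).
have Fatom j : F j = set0 \/ xi (F j).
  have [[B [xiB BA fB]]|nB] := pselect (exists B, [/\ xi B, B `<=` A & f B = j]).
    right; suff -> : F j = B by [].
    apply/seteqP; split=> [x [C [xiC _ fC]]|x Bx]; last by exists B.
    by have <- : C = B by apply: finj; rewrite ?inE// fC fB.
  by left; rewrite -subset0 => x [B BA _]; apply: nB; exists B.
have mF j : measurable (F j) by have [->//|/mxi] := Fatom j.
have tF : trivIset setT F.
  move=> i j _ _ [x [[B [xiB _ <-] Bx] [C [xiC _ <-] Cx]]].
  by have -> : B = C := txi B C xiB xiC (ex_intro _ x (conj Bx Cx)).
have mUF : measurable (\bigcup_j F j) by exact: bigcupT_measurable.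
rewrite AF !measure_semi_bigcup//; apply: lee_nneseries => // j _.
by have [->|/m12//] := Fatom j; rewrite !measure0.
Qed.

(** The absolute value splits into two one-sided bounds, each comparing a probability with a measure
    of the form [m' + e nu], to which [le_measure_refined] applies. *)
Lemma measure_close_refined d (X : measurableType d) (R : realType)
    (mu nu : probability X R) (e : R) (eta xi : set (set X)) :
  measurable_partition eta -> measurable_partition xi -> countable xi ->
  refines eta xi -> 0 <= e ->
  (forall B, xi B -> (`|mu B - nu B| <= e%:E * nu B)%E) ->
  forall A, eta A -> `|fine (mu A) - fine (nu A)| <= e * fine (nu A).
Proof.
move=> peta pxi cxi r e0 close A eA.
have mA : measurable A by have [_ meta] := peta; exact: meta.
have mB B : xi B -> measurable B by have [_ mxi] := pxi; exact: mxi.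
pose en : {nonneg R} := NngNum e0.
have addE (m : probability X R) B : measurable B ->
    (measure_add m (mscale en nu) B = (fine (m B) + e * fine (nu B))%:E)%E.
  move=> mb; rewrite measure_addE EFinD EFinM !fineK ?fin_num_measure//.
have closeR B : xi B -> `|fine (mu B) - fine (nu B)| <= e * fine (nu B).
  move=> xiB; have := close _ xiB.
  have muB := fin_num_measure mu B (mB _ xiB).
  have nuB := fin_num_measure nu B (mB _ xiB).
  by rewrite -lee_fin EFinM -abse_EFin EFinB !fineK.
(* Applied with [(m, m')] equal to [(mu, nu)] and then to [(nu, mu)]; the error is measured by [nu]
   both times. *)
have transfer (m m' : probability X R) :
    (forall B, xi B -> fine (m B) <= fine (m' B) + e * fine (nu B)) ->
    fine (m A) <= fine (m' A) + e * fine (nu A).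
  move=> mm'; rewrite -lee_fin fineK ?fin_num_measure// -(addE m' A mA).
  apply: (le_measure_refined peta pxi cxi r) eA => B xiB.
  rewrite [leRHS](addE m' B (mB B xiB)).
  rewrite -[leLHS]fineK ?fin_num_measure//; last exact: mB.
  by rewrite lee_fin; exact: mm'.
have h1 : fine (mu A) <= fine (nu A) + e * fine (nu A).
  by apply: transfer => B /closeR; rewrite ler_norml => /andP[_]; rewrite lerBlDl.
have h2 : fine (nu A) <= fine (mu A) + e * fine (nu A).
  by apply: transfer => B /closeR; rewrite ler_norml => /andP[+ _];
    rewrite lerNl opprB lerBlDl.
by rewrite ler_norml lerNl opprB !lerBlDl h1 h2.
Qed.

(* The closeness is multiplicative, so [y = 0] forces [x n = 0] eventually:
   continuity of [ln] is only needed at [y > 0]. *)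
Lemma cvg_entropy_term (R : realType) (x eps : nat -> R) (y : R) :
  0 <= y -> eps n @[n --> \oo] --> (0 : R) ->
  (\forall n \near \oo, 0 <= x n <= 1 /\ `|y - x n| <= eps n * x n) ->
  - (x n * ln (x n)) @[n --> \oo] --> - (y * ln y).
Proof.
move=> y0 eps0 xy.
have eps1 : \forall n \near \oo, eps n < 1 by exact: cvgr_lt eps0 _ ltr01.
move: y0; rewrite le_eqVlt => /predU1P[y0|y0].
  rewrite -y0 mul0r in xy *; apply: cvg_near_cst.
  near=> n.
  have [/andP[x0 x1] xe] : 0 <= x n <= 1 /\ `|0 - x n| <= eps n * x n by near: n.
  have e1 : eps n < 1 by near: n.
  have -> : x n = 0.
    move: xe; rewrite sub0r normrN ger0_norm// => xe; nra.
  by rewrite mul0r.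
have xcvg : x n @[n --> \oo] --> y.
  apply/cvgrPdist_le => e e0; near=> n.
  have [/andP[x0 x1] xe] : 0 <= x n <= 1 /\ `|y - x n| <= eps n * x n by near: n.
  have ee : eps n < e by near: n; exact: cvgr_lt eps0 _ e0.
  (* Since [0 <= x n <= 1], the relative error [eps n * x n] is at most [e]. *)
  apply: (le_trans xe); nra.
apply: cvgN; apply: cvgM => //.
exact: (cvg_comp _ _ xcvg (continuous_ln y0)).
Unshelve. all: by end_near. Qed.

(** The terms are finite in number and indexed by a fixed set, so convergence of each one suffices.
    This is a reason for replacing [xi] by a finite partition. *)
Lemma cvg_fin_entropy d (X : measurableType d) (R : realType)
    (mu : probability X R) (mu_ : nat -> probability X R) (eps : nat -> R)
    (eta : set (set X)) :
  finite_set eta -> eta `<=` measurable -> eps n @[n --> \oo] --> (0 : R) ->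
  (\forall n \near \oo, forall A, eta A ->
     `|fine (mu A) - fine (mu_ n A)| <= eps n * fine (mu_ n A)) ->
  fin_entropy (mu_ n) eta @[n --> \oo] --> fin_entropy mu eta.
Proof.
move=> feta meta eps0 close; rewrite /fin_entropy.
under eq_fun do rewrite (fsbig_finite _ _ feta) /= big_seq.
rewrite (fsbig_finite _ _ feta) /= [X in nbhs X]big_seq.
apply: cvg_big => [|A]; first exact: add_continuous.
rewrite in_fset_set// => /set_mem eA.
apply: (@cvg_entropy_term _ _ eps) => //; first by rewrite fine_ge0.
near=> n; split; first by apply/fine_probability/meta.
by move: A eA; near: n.
Unshelve. all: by end_near. Qed.

(** * The finite partition obtained by merging a tail of atoms *)

Lemma bigcup_countable_measurable d (X : measurableType d) (D : set (set X)) :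
  countable D -> D `<=` measurable -> measurable (\bigcup_(A in D) A).
Proof.
move=> cD mD; rewrite bigcup_set_type; apply: countable_bigcupT_measurable.
  by rewrite (eq_countable (card_setT _)).
by move=> A; apply: mD; exact: set_valP.
Qed.

(** Countability of [xi] makes the merged atom measurable. *)
Lemma merge_tail_partition d (X : measurableType d) (xi : set (set X))
    (label : set X -> nat) (k : nat) :
  measurable_partition xi -> countable xi ->
  measurable_partition (merge_tail xi label k).
Proof.
move=> [[cxi_ txi nxi] mxi] cxi.
pose tail := \bigcup_(A in [set A | xi A /\ (k <= label A)%N]) A.
(* A common point would lie in a merged atom of [xi], which then equals [A]; its label would be both
   below [k] and at least [k]. *)
have disj A : xi A -> (label A < k)%N -> A `&` tail !=set0 -> False.
  move=> xA lA [x [Ax [B [xB lB] Bx]]].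
  have AB : A = B := txi A B xA xB (ex_intro _ x (conj Ax Bx)).
  by rewrite AB ltnNge lB in lA.
split; [split|].
- rewrite -subTset => x _; have [A xA Ax] : cover xi id x by rewrite cxi_.
  have [lA|lA] := ltnP (label A) k.
    by exists A => //; split; [left|move=> /= A0; rewrite A0 in Ax].
  have tx : tail x by exists A.
  by exists tail => //; split; [right|move=> /= t0; rewrite t0 in tx].
- move=> A B [[[xA lA]|->] _] [[[xB lB]|->] _] AB //.
  + exact: (txi A B xA xB AB).
  + by case: (disj A).
  + by case: (disj B) => //; rewrite setIC.
- by move=> A [_ /= /eqP/set0P].
- move=> A [[[/mxi]|->] _] //.
  apply: bigcup_countable_measurable => [|B [/mxi]//].
  by apply: sub_countable cxi; apply: subset_card_le => B [].
Qed.

Lemma refines_merge_tail (X : Type) (xi : set (set X)) (label : set X -> nat) k :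
  ~ xi set0 -> refines (merge_tail xi label k) xi.
Proof.
move=> xi0 B xB; have B0 : B !=set0 by apply/set0P/eqP => B0; rewrite B0 in xB.
have [lB|lB] := ltnP (label B) k.
  by exists B => //; split; [left|apply/eqP/set0P].
exists (\bigcup_(A in [set A | xi A /\ (k <= label A)%N]) A).
  split; first by right.
  by case: B0 => x Bx; apply/eqP/set0P; exists x, B.
by move=> x Bx; exists B.
Qed.

(** The labels inject the unmerged atoms into the numbers below [k], and merging adds at most one
    atom. *)
Lemma finite_merge_tail (X : Type) (xi : set (set X)) (label : set X -> nat) k :
  (forall A B, xi A -> xi B -> label A = label B -> A = B) ->
  finite_set (merge_tail xi label k).
Proof.
move=> linj; apply: finite_setD; rewrite finite_setU; split; last exact: finite_set1.
rewrite -(eq_finite_set (@inj_card_eq _ _ _ label _)); last first.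
  by move=> A B /set_mem[xA _] /set_mem[xB _]; exact: linj.
by apply: (@sub_finite_set _ _ `I_k) => // _ [A [_ lA] <-].
Qed.

(** * Entropy of a transformation *)

Lemma can_iter (X : Type) (T S : X -> X) n :
  cancel S T -> cancel (iter n S) (iter n T).
Proof. by move=> ST; elim: n => // n ih x; rewrite [iter n.+1 T _]iterSr iterS ST ih. Qed.

Lemma measurable_fun_iter d (X : measurableType d) (T : X -> X) n :
  measurable_fun setT T -> measurable_fun setT (iter n T).
Proof.
by move=> mT; elim: n => [|n ih]; [exact: measurable_id|exact: measurableT_comp].
Qed.

Lemma invariant_measure_iter d (X : measurableType d) (R : realType)
    (T : X -> X) (mu : probability X R) n :
  measurable_fun setT T -> invariant_measure T mu ->
  invariant_measure (iter n T) mu.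
Proof.
move=> mT inv; elim: n => [|n ih] A mA; first by rewrite preimage_id.
rewrite -[RHS]ih// -[RHS]inv.
  by congr (mu _); apply/seteqP; split=> x; rewrite /preimage /= -iterSr.
by rewrite -[X in measurable X]setTI; exact: measurable_fun_iter.
Qed.

(** By invariance under the [n]-th iterate, the second factor in [join_iterD] has the same entropy
    as the join of length [m]. This is the subadditivity that [fekete] requires. *)
Lemma fin_entropy_join_iterD d (X : measurableType d) (R : realType)
    (mu : probability X R) (T S : X -> X) (eta : set (set X)) n m :
  [set: X] !=set0 -> measurable_fun setT T -> cancel S T ->
  invariant_measure T mu -> measurable_partition eta -> finite_set eta ->
  fin_entropy mu (join_iter T eta (n + m)) <=
  fin_entropy mu (join_iter T eta n) + fin_entropy mu (join_iter T eta m).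
Proof.
move=> X0 mT ST inv peta feta; rewrite (join_iterD _ _ X0 mT ST peta).
have pj k := measurable_join_iter k X0 mT ST peta.
have fj k := finite_join_iter k ST feta.
have mTn : measurable_fun setT (iter n T) by exact: measurable_fun_iter.
have invn := invariant_measure_iter n mT inv.
rewrite -(fin_entropy_preimage (can_iter n ST) invn (pj m).2).
apply: fin_entropy_join => //.
- exact: measurable_preimage_partition (can_iter n ST) _.
- exact: finite_image.
Qed.

(** The index 0 is excluded because the inverse of 0 is 0 by convention: it would put 0 into the set
    and make the infimum trivial. *)
Definition mean_entropies d (X : measurableType d) (R : realType)
    (mu : probability X R) (T : X -> X) (eta : set (set X)) : set R :=
  [set k%:R^-1 * fin_entropy mu (join_iter T eta k) | k in [set k | (0 < k)%N]].

Lemma has_inf_mean_entropies d (X : measurableType d) (R : realType)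
    (mu : probability X R) (T S : X -> X) (eta : set (set X)) :
  [set: X] !=set0 -> measurable_fun setT T -> cancel S T ->
  measurable_partition eta -> has_inf (mean_entropies mu T eta).
Proof.
move=> X0 mT ST peta; split.
  by exists (1%:R^-1 * fin_entropy mu (join_iter T eta 1)); exists 1%N.
exists 0 => _ [k _ <-]; rewrite mulr_ge0 ?invr_ge0// fin_entropy_ge0//.
by have [] := measurable_join_iter k X0 mT ST peta.
Qed.

(** Fekete's lemma turns the limit into an infimum, so that any single [k] bounds the entropy from
    above. *)
Lemma entropy_wrtE d (X : measurableType d) (R : realType)
    (mu : probability X R) (T S : X -> X) (eta : set (set X)) :
  [set: X] !=set0 -> measurable_fun setT T -> cancel S T ->
  invariant_measure T mu -> measurable_partition eta -> finite_set eta ->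
  entropy_wrt mu T eta = (inf (mean_entropies mu T eta))%:E.
Proof.
move=> X0 mT ST inv peta feta; apply: cvg_lim => //.
have pj k := measurable_join_iter k X0 mT ST peta.
have fj k := finite_join_iter k ST feta.
under eq_fun do rewrite (partition_entropyE mu (fj _) (pj _).2) -EFinM.
apply: cvg_EFin; first exact: nearW.
apply: fekete => [n|n m]; first exact: fin_entropy_ge0 (pj n).2.
exact: fin_entropy_join_iterD ST _ _ _.
Qed.

(** * Upper limits of entropies along a sequence of measures *)

Lemma limn_esup_le_near (R : realType) (u : nat -> \bar R) (c : \bar R) :
  (\forall n \near \oo, (u n <= c)%E) -> (limn_esup u <= c)%E.
Proof.
(* [limn_esup] is an infimum of suprema over the neighbourhoods of infinity, and the set where
   [u n <= c] is one of them. *)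
move=> uc; apply: ge_ereal_inf; exists (ereal_sup (u @` [set n | (u n <= c)%E])).
  by exists [set n | (u n <= c)%E].
by apply: ge_ereal_sup => _ [n un <-].
Qed.

(** An infimum of quantities that converge is upper semicontinuous: one [k] whose mean entropy is
    within [e] of the infimum for [mu] controls the entropies for all large [n]. *)
Lemma limn_esup_entropy_wrt_le d (X : measurableType d) (R : realType)
    (T S : X -> X) (mu : probability X R) (mu_ : nat -> probability X R)
    (r : nat -> nat) (eps : nat -> R) (xi eta : set (set X)) :
  measurable_fun setT T -> cancel S T ->
  invariant_measure T mu ->
  (\forall n \near \oo, invariant_measure T (mu_ n)) ->
  measurable_partition xi -> countable xi ->
  r n @[n --> \oo] --> \oo -> eps n @[n --> \oo] --> (0 : R) ->
  (\forall n \near \oo, 0 <= eps n) ->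
  (\forall n \near \oo, forall A, join_iter T xi (r n).+1 A ->
     (`|mu A - mu_ n A| <= (eps n)%:E * mu_ n A)%E) ->
  measurable_partition eta -> finite_set eta -> refines eta xi ->
  (limn_esup (fun n => entropy_wrt (mu_ n) T eta) <= entropy_wrt mu T eta)%E.
Proof.
move=> mT ST inv inv_ pxi cxi roo eps0 eps_ge0 close peta feta ref.
(* A space of total mass 1 is not empty. *)
have X0 : [set: X] !=set0.
  apply/set0P/eqP => X0; have := probability_setT mu.
  by rewrite X0 measure0 => /eqP; rewrite eq_sym onee_eq0.
rewrite (entropy_wrtE X0 mT ST inv peta feta).
apply/lee_addgt0Pr => e e0.
have [_ [k k0 <-] ke] := inf_adherent e0 (has_inf_mean_entropies mu X0 mT ST peta).
have fj := finite_join_iter k ST feta.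
have pj := measurable_join_iter k X0 mT ST peta.
have cvgk : k%:R^-1 * fin_entropy (mu_ n) (join_iter T eta k) @[n --> \oo] -->
    k%:R^-1 * fin_entropy mu (join_iter T eta k).
  apply: cvgM; first exact: cvg_cst.
  apply: (cvg_fin_entropy fj pj.2 eps0).
  near=> n; apply: (measure_close_refined (xi := join_iter T xi (r n).+1)) => //.
  - exact: measurable_join_iter ST _.
  - exact: countable_join_iter ST _.
  (* Two coarsenings: from [xi] to [eta] at length [k], and from length [(r n).+1] to length [k].
     The join in (ii) runs over [0 <= i <= r n], hence has [(r n).+1] factors. *)
  - refine (refines_trans (refines_join_iter ST ref) _).
    apply: (refines_join_iter_leq X0 mT ST pxi).
    by near: n; move/cvgnyPge : roo => /(_ k); apply: filterS => n /leqW.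
  - by near: n.
  - by near: n.
apply: limn_esup_le_near; near=> n.
have invn : invariant_measure T (mu_ n) by near: n.
rewrite (entropy_wrtE X0 mT ST invn peta feta) -EFinD lee_fin.
apply: (@le_trans _ _ (k%:R^-1 * fin_entropy (mu_ n) (join_iter T eta k))).
  by apply: ge_inf; [have [] := has_inf_mean_entropies (mu_ n) X0 mT ST peta|exists k].
(* The inequality [ke] is strict, so the convergent means for [mu_ n] eventually fall below the
   infimum plus [e]. *)
by near: n; exact: cvgr_le cvgk _ ke.
Unshelve. all: by end_near. Qed.

Theorem theorem5 (R : realType) (d : measure_display) (X : measurableType d)
  (T : X -> X) (hT : automorphism T)
  (xi : set (set X)) (hxi : measurable_partition xi) (cxi : countable xi)
  (mu : probability X R) (hmu : invariant_measure T mu)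
  (mu_ : nat -> probability X R)
  (hmu_ : forall n, (1 <= n)%N -> invariant_measure T (mu_ n))
  (r : nat -> nat) (eps : nat -> R)
  (eps_gt0 : forall n, (1 <= n)%N -> 0 < eps n)
  (r_cvg : r n @[n --> \oo] --> \oo)
  (eps_cvg : eps n @[n --> \oo] --> (0 : R))
  (close : forall n, (1 <= n)%N -> forall A, join_iter T xi (r n).+1 A ->
     (`|mu A - mu_ n A| <= (eps n)%:E * mu_ n A)%E)
  (gen : is_generator mu T xi)
  (gen_ : forall n, (1 <= n)%N -> is_generator (mu_ n) T xi)
  (label : set X -> nat)
  (label_gt0 : forall A, xi A -> (1 <= label A)%N)
  (label_inj : forall A B, xi A -> xi B -> label A = label B -> A = B)
  (q : nat -> nat)
  (q_gt0 : forall m, (1 <= m)%N -> (1 <= q m)%N)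
  (q_incr : forall m1 m2, (1 <= m1)%N -> (m1 < m2)%N -> (q m1 < q m2)%N) :
  (limn_esup (fun m : nat => limn_esup (fun n : nat =>
     entropy_wrt (mu_ n) T (merge_tail xi label (q m))))
   <= ks_entropy mu T)%E.
Proof.
have [mT [S [_ ST _]]] := hT.
(* The bound holds for each [m] separately, so no limit in [m] has to be computed. *)
apply: limn_esup_le_near; apply: nearW => m.
have ptail := merge_tail_partition label (q m) hxi cxi.
have ftail := finite_merge_tail (q m) label_inj.
apply: (@le_trans _ _ (entropy_wrt mu T (merge_tail xi label (q m)))).
  apply: (limn_esup_entropy_wrt_le (r := r) (eps := eps) mT ST hmu _ hxi cxi) => //.
  (* The assumptions on [mu_ n] and [eps n] are given for [n >= 1], which is enough near
     infinity. *)
  - by near do apply: hmu_.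
  - by near do apply/ltW/eps_gt0.
  - by near do apply: close.
  - exact/refines_merge_tail/partition_not_set0.
(* The merged partition is finite and measurable, hence one of those over which [ks_entropy] takes
   its supremum. *)
by apply: ereal_sup_ubound; exists (merge_tail xi label (q m)).
Unshelve. all: by end_near. Qed.
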